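(* Let $p$ be a prime such that $2$ is a primitive root modulo $p$ and $p \equiv 2^i + 1 \pmod{2^{i+1}}$ for some integer $i \geq 1$. Suppose that $p$ satisfies the following condition: for every integer $\delta$ with $1 \leq \delta < p$, there exist an odd prime power $q \equiv 1 \pmod{p}$ and a positive integer $d \equiv \delta \pmod{p}$ such that $r = \frac{q^d-1}{q-1}$ is a prime power with $r \equiv 1 \pmod{4}$. Let $j$ be an integer with $0 \leq j \leq i$. Then, for all but finitely many positive integers $n$, the following holds: if $n$ is invertible modulo $p$ with $4n^{-1} \equiv a^{2^j} \pmod{p}$ for some integer $a$ (where $n^{-1}$ is the inverse of $n$ modulo $p$), and if $n \equiv 0 \pmod{2^{i-j}}$, then an $MH(n,p)$ exists.
   Context: For positive integers $n, m$, an $MH(n,m)$ (an $m$-modular Hadamard matrix of size $n$) is an $n \times n$ matrix $H$ with all entries in $\{+1,-1\}$ such that $HH^\top \equiv nI \pmod{m}$ (entrywise), where $I$ is the identity matrix. A prime power is an integer of the form $\ell^e$ with $\ell$ prime and $e \geq 1$ (so $1$ is not a prime power). *)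

(* Defs.v *)
From mathcomp Require Import all_boot all_order all_algebra.

Set Implicit Arguments.
Unset Strict Implicit.
Unset Printing Implicit Defensive.

Import GRing.Theory.

Definition prime_power (q : nat) : Prop :=
  exists l e : nat, [/\ prime l, 0 < e & q = l ^ e].

Definition is_MH (m n : nat) (H : 'M[int]_n) : Prop :=
  (forall i j : 'I_n, H i j = 1%R \/ H i j = (-1)%R) /\
  (forall i j : 'I_n,
     ((H *m H^T)%R i j = (n%:R%:M : 'M[int]_n)%R i j %[mod m])%Z).

Definition MH_exists (n m : nat) : Prop := exists H : 'M[int]_n, is_MH m H.

(* The multiplicative order of 2 modulo p is p - 1; for prime p, 'F_p is
   Z/pZ. *)
Definition two_primitive_root (p : nat) : Prop :=
  (p.-1.-primitive_root (2%:R : 'F_p))%R.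

(* For d >= 1 the division is exact: the value is 1 + q + ... + q^(d-1). *)
Definition repunit (q d : nat) : nat := (q ^ d - 1) %/ (q - 1).

Definition repunit_condition (p : nat) : Prop :=
  forall delta : nat, 1 <= delta < p ->
  exists q d : nat,
    [/\ odd q, prime_power q & q = 1 %[mod p]] /\
    [/\ 0 < d, d = delta %[mod p], prime_power (repunit q d)
      & repunit q d = 1 %[mod 4]].

(* Main.v *)
Require Import Defs.
From mathcomp Require Import all_boot all_order all_algebra all_solvable all_field.
From mathcomp Require Import ring zify.

(* In an MH(n,p), a 1 x 1 block may be replaced by any v x v sign matrix A
   that looks like a 1 x 1 block modulo p: v = 1, unit row sums, and
   A A^T = n I + (1 - n) J.  If r is a prime power with n r = 4 and r^o = 1
   modulo p, the points and hyperplanes of PG(o, r) give such an A, so n can be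
   increased repeatedly by G = r + ... + r^o.  With r = 1 mod 4 and
   o = (p - 1) / 2^j, the 2-part of G is 2^(i - j).  As starting points serve
   the orders 2^s (4 + p t) with 2^s = 1 / r modulo p: since J - 2 I is an
   MH(n,p) for every n = 4 mod p, these exist by Sylvester doubling, and they
   cover every admissible residue class modulo G.  If r = 1 modulo p, then
   n = 4 modulo p, and J - 2 I already works. *)

Set Implicit Arguments.
Unset Strict Implicit.
Unset Printing Implicit Defensive.

Import GRing.Theory.

(** * Orthogonal sign matrices over a field: doubling and inflation *)

Section HadamardOver.

Local Open Scope ring_scope.

Variable K : fieldType.

(* [true] encodes the entry -1.  Distinct rows are orthogonal over [K]; the
   diagonal condition is automatic for sign matrices. *)
Definition hadamard_over (T : finType) (h : T -> T -> bool) : Prop :=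
  forall x y, x != y -> \sum_z (-1) ^+ (h x z (+) h y z) = 0 :> K.

Definition has_hadamard (n : nat) : Prop :=
  exists h : 'I_n -> 'I_n -> bool, hadamard_over h.

Lemma has_hadamard_card (T : finType) (h : T -> T -> bool) :
  hadamard_over h -> has_hadamard #|T|.
Proof.
move=> hP; exists (fun x y => h (enum_val x) (enum_val y)) => x y nxy.
rewrite -(big_enum_val (A := T)
  (fun z => (-1) ^+ (h (enum_val x) z (+) h (enum_val y) z))) /=.
by apply: hP; apply: contraNneq nxy => /enum_val_inj ->.
Qed.

Lemma sum_sign_pred1 n (x : 'I_n) (G : 'I_n -> K) :
  \sum_z (-1) ^+ (z == x) * G z = \sum_z G z - G x *+ 2.
Proof.
rewrite (bigD1 x) //= [in RHS](bigD1 x) //= eqxx expr1.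
rewrite (eq_bigr (fun z => G z)) => [|z /negbTE->]; last by rewrite expr0 mul1r.
by ring.
Qed.

(** The witness is J - 2 I: two distinct rows differ in exactly two places, so their inner product
    is n - 4. *)
Lemma has_hadamard_eq4 n : n%:R = 4%:R :> K -> has_hadamard n.
Proof.
move=> n4; exists (fun x z => z == x) => x y nxy.
under eq_bigr do rewrite signr_addb.
rewrite sum_sign_pred1 (negbTE nxy) expr0.
under eq_bigr do rewrite -[(-1) ^+ _]mulr1.
rewrite (sum_sign_pred1 y (fun=> 1)) sumr_const card_ord n4.
by ring.
Qed.

(** Kronecker product with the 2 x 2 Sylvester matrix, whose signs are [s && u]. *)
Lemma has_hadamard_double n : has_hadamard n -> has_hadamard (2 * n).
Proof.
move=> [h hP].
have -> : (2 * n = #|{: bool * 'I_n}|)%N by rewrite card_prod card_bool card_ord.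
apply: (@has_hadamard_card _ (fun a b => h a.2 b.2 (+) (a.1 && b.1))).
move=> [s x] [t y] nst /=.
rewrite -(pair_bigA _ (fun u z => (-1) ^+ (h x z (+) (s && u) (+) (h y z (+) (t && u))))) /=.
under eq_bigr => u _ do under eq_bigr => z _ do
  rewrite addbACA signr_addb mulrC.
under eq_bigr => u _ do rewrite -mulr_sumr.
rewrite -mulr_suml big_bool !andbT !andbF expr0.
(* The factor over z vanishes unless x = y; then s and t differ and the factor over u is 0. *)
case: (eqVneq x y) nst => [-> | nxy _]; last by rewrite hP // mulr0.
case: s t => -[] /=; rewrite ?xpair_eqE ?eqxx //= => _;
  by rewrite !expr1 ?subrr ?addNr mul0r.
Qed.

Lemma has_hadamard_pow2 s n : has_hadamard n -> has_hadamard (2 ^ s * n).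
Proof.
move=> hn; elim: s => [|s IHs]; first by rewrite mul1n.
by rewrite expnS -mulnA; apply: has_hadamard_double.
Qed.

(* A 1x1 block e of an n x n matrix is inflated to the block eA; the row and
   the column through that entry are repeated.  Modulo the characteristic, A
   cannot be told apart from a 1x1 block. *)
Lemma has_hadamard_inflate n (V : finType) (A : V -> V -> bool) :
    #|V|%:R = 1 :> K ->
    (forall x, \sum_z (-1) ^+ A x z = 1 :> K) ->
    (forall x y, x != y -> \sum_z (-1) ^+ (A x z (+) A y z) = 1 - n.+1%:R :> K) ->
  has_hadamard n.+1 -> has_hadamard (n + #|V|).
Proof.
move=> V1 A1 AA [h hP].
have -> : (n + #|V| = #|{: 'I_n + V}|)%N by rewrite card_sum card_ord.
(* The inflated entry sits at [(ord0, ord0)]; [l] enumerates the other indices. *)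
pose l (i : 'I_n) := lift ord0 i.
pose h' (a b : 'I_n + V) := match a, b with
  | inl i, inl k => h (l i) (l k) | inl i, inr _ => h (l i) ord0
  | inr _, inl k => h ord0 (l k) | inr v, inr w => h ord0 ord0 (+) A v w end.
(* Since [A] has row sums 1, its columns together contribute what column [ord0] did. *)
have cross i v : \sum_z (-1) ^+ (h' (inl i) z (+) h' (inr v) z) = 0 :> K.
  rewrite -[RHS](hP (l i) ord0 isT) big_ord_recl big_sumType /= addrC.
  congr (_ + _).
  under eq_bigr do rewrite addbA signr_addb.
  by rewrite -mulr_sumr A1 mulr1.
apply: (@has_hadamard_card _ h') => -[x|x] [y|y] nxy.
- have lxy : l x != l y by apply: contraNneq nxy => /lift_inj ->.
  rewrite -[RHS](hP _ _ lxy) big_ord_recl big_sumType /= addrC.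
  by congr (_ + _); rewrite sumr_const -mulr_natl V1 mul1r.
- exact: cross.
- by rewrite -[RHS](cross y x); apply: eq_bigr => z _; rewrite addbC.
(* The n outer columns agree and give n; the block gives 1 - (n + 1). *)
- rewrite big_sumType /=.
  under eq_bigr do rewrite addbb expr0.
  under [X in _ + X]eq_bigr do rewrite addbACA addbb addFb.
  rewrite AA; last by apply: contraNneq nxy => ->.
  by rewrite sumr_const card_ord -natr1; ring.
Qed.

End HadamardOver.

(** * Points of projective space over a finite field *)

Section ProjectiveGeometry.

Local Open Scope ring_scope.

Variables (F : finFieldType) (d : nat).

(** The default 0 keeps [leading] homogeneous at the zero vector, the only place where it
    vanishes. *)
Definition leading (x : 'rV[F]_d) : F :=
  if [pick i | x 0 i != 0] is Some i then x 0 i else 0.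

(* Each point of the projective space PG(d-1, F) is represented by its unique
   homogeneous vector whose first nonzero coordinate is 1. *)
Definition proj_points : {set 'rV[F]_d} := [set x | leading x == 1].

Definition dot (x z : 'rV[F]_d) : F := (x *m z^T) 0 0.

Lemma leadingZ a x : leading (a *: x) = a * leading x.
Proof.
have [->|nz_a] := eqVneq a 0.
  by rewrite scale0r mul0r /leading; case: pickP => // i; rewrite mxE eqxx.
rewrite /leading (eq_pick (Q := fun i => x 0 i != 0)); last first.
  by move=> i; rewrite /= mxE mulf_eq0 negb_or nz_a.
by case: pickP => [i _|_]; rewrite ?mxE ?mulr0.
Qed.

Lemma leading_eq0 x : (leading x == 0) = (x == 0).
Proof.
apply/idP/idP => [|/eqP->]; last by rewrite -(scale0r 0) leadingZ mul0r.
rewrite /leading; case: pickP => [i /negbTE -> //|x0 _].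
by apply/eqP/rowP=> i; have /negbFE/eqP := x0 i; rewrite mxE.
Qed.

Lemma dotZr a x z : dot x (a *: z) = a * dot x z.
Proof. by rewrite /dot linearZ /= -scalemxAr mxE. Qed.

Lemma dotDr x z w : dot x (z + w) = dot x z + dot x w.
Proof. by rewrite /dot linearD /= mulmxDr mxE. Qed.

Lemma dot0r x : dot x 0 = 0.
Proof. by rewrite /dot trmx0 mulmx0 mxE. Qed.

(** Every nonzero vector is uniquely a nonzero scalar times a representative; grouping by leading
    coefficient gives |F| - 1 equal sums. *)
Lemma sum_proj_points (R : nzRingType) (f : 'rV[F]_d -> R) :
    (forall a x, a != 0 -> f (a *: x) = f x) ->
  (\sum_(x in proj_points) f x) *+ #|F|.-1 = \sum_x f x - f 0.
Proof.
move=> fZ; rewrite [X in _ = X - _](bigD1 0) //= addrAC subrr add0r.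
rewrite [RHS](partition_big leading (fun a => a != 0)) /=; last first.
  by move=> x; rewrite leading_eq0.
have -> : #|F|.-1 = #|[pred a : F | a != 0]| by rewrite (cardC1 (0 : F)).
rewrite -sumr_const; apply: eq_bigr => a nz_a.
rewrite [RHS](reindex (GRing.scale a)) /=; last first.
  by exists (GRing.scale a^-1) => x _; rewrite scalerA ?mulVf ?mulfV ?scale1r.
apply: eq_big => [x|x _]; last by rewrite fZ.
rewrite inE leadingZ scaler_eq0 (negbTE nz_a) /= -leading_eq0.
rewrite -{2}[a]mulr1 (inj_eq (mulfI nz_a)).
by case: eqVneq => [->|]; rewrite ?oner_eq0 ?andbF.
Qed.

Lemma card_proj_points : (#|proj_points| * #|F|.-1 = (#|F| ^ d).-1)%N.
Proof.
have := @sum_proj_points int (fun=> 1) (fun _ _ _ => erefl).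
rewrite !sumr_const card_mx mul1n.
have q_gt0 : (0 < #|F|)%N by apply/card_gt0P; exists 0.
have := expn_gt0 #|F| d; rewrite q_gt0 /= => qd_gt0.
rewrite -[in X in _ = X](prednK qd_gt0) -mulrnA mulrSr addrK => /eqP.
by rewrite Num.Theory.eqr_nat => /eqP.
Qed.

(** Distinct representatives are linearly independent, so the matrix with rows x and y has a right
    inverse; its columns are u and w. *)
Lemma proj_points_indep x y : x \in proj_points -> y \in proj_points -> x != y ->
  exists u w, [/\ dot x u = 1, dot y u = 0, dot x w = 0 & dot y w = 1].
Proof.
rewrite !inE => /eqP lx /eqP ly nxy.
have: row_free (col_mx x y).
  apply: inj_row_free => v; rewrite -[v]hsubmxK mul_row_col.
  rewrite [lsubmx v]mx11_scalar [rsubmx v]mx11_scalar !mul_scalar_mx.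
  move: (lsubmx v 0 0) (rsubmx v 0 0) => a b /eqP; rewrite addr_eq0 => /eqP ab.
  (* Both leading coefficients are 1, so a x = - b y forces a = - b. *)
  have ba : a = - b.
    by have := congr1 leading ab; rewrite -scaleNr !leadingZ lx ly !mulr1.
  have: b *: (x - y) = 0.
    by apply/eqP; rewrite scalerBr subr_eq0 -eqr_opp -ab -scaleNr ba.
  move=> /eqP; rewrite scaler_eq0 subr_eq0 (negbTE nxy) orbF => /eqP b0.
  by rewrite ba b0 oppr0 !raddf0 row_mx0.
case/row_freeP=> B; rewrite mul_col_mx => xyB.
have E i k : (col_mx (x *m B) (y *m B)) i k = (i == k)%:R by rewrite xyB mxE.
exists (col (lshift 1 0) B)^T, (col (rshift 1 0) B)^T.
rewrite /dot !trmxK !colE !mulmxA -!colE; split; rewrite mxE.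
- by have := E (lshift 1 0) (lshift 1 0); rewrite col_mxEu eqxx.
- by have := E (rshift 1 0) (lshift 1 0); rewrite col_mxEd.
- by have := E (lshift 1 0) (rshift 1 0); rewrite col_mxEu.
- by have := E (rshift 1 0) (rshift 1 0); rewrite col_mxEd eqxx.
Qed.

Lemma proj_point_dual x : x \in proj_points -> exists u, dot x u = 1.
Proof.
rewrite inE /leading; case: pickP => [i _ /eqP xi|_]; last by rewrite eq_sym oner_eq0.
by exists (delta_mx 0 i); rewrite /dot trmx_delta -colE mxE.
Qed.

(** * Incidence sums of points and hyperplanes, with values in [K] *)

Section IncidenceSums.

Variable K : fieldType.
Local Notation q := (#|F|%:R : K).

(* Averaging over the translates of z by a vector u with x . u = 1. *)
Lemma sum_dot (x u : 'rV[F]_d) (g : F -> K) : dot x u = 1 ->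
  q * (\sum_z g (dot x z)) = q ^+ d * \sum_s g s.
Proof.
move=> xu; transitivity (\sum_z \sum_s g (dot x (z + s *: u))).
  rewrite exchange_big /= mulr_natl -sumr_const; apply: eq_bigr => s _.
  by rewrite [RHS](reindex_inj (addIr (- (s *: u)))) /=; under [RHS]eq_bigr do rewrite subrK.
transitivity (\sum_(z : 'rV[F]_d) \sum_s g s); last first.
  by rewrite sumr_const card_mx mul1n -natrX mulr_natl.
apply: eq_bigr => z _; rewrite [RHS](reindex_inj (addrI (dot x z))) /=.
by apply: eq_bigr => s _; rewrite dotDr dotZr xu mulr1.
Qed.

(** Translating z by multiples of w moves y . z through all of F and fixes x . z, so the two factors
    separate. *)
Lemma sum_dot2 (x y u w : 'rV[F]_d) (g1 g2 : F -> K) :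
    dot x u = 1 -> dot y u = 0 -> dot x w = 0 -> dot y w = 1 ->
  q ^+ 2 * (\sum_z g1 (dot x z) * g2 (dot y z)) =
    q ^+ d * ((\sum_s g1 s) * \sum_s g2 s).
Proof.
move=> xu yu xw yw; rewrite expr2 -mulrA.
transitivity (q * \sum_z g1 (dot x z) * \sum_t g2 t); last first.
  by rewrite -mulr_suml mulrA (sum_dot _ xu) mulrA.
congr (_ * _); transitivity (\sum_z \sum_t g1 (dot x (z + t *: w)) * g2 (dot y (z + t *: w))).
  rewrite exchange_big /= mulr_natl -sumr_const; apply: eq_bigr => s _.
  by rewrite [RHS](reindex_inj (addIr (- (s *: w)))) /=; under [RHS]eq_bigr do rewrite subrK.
apply: eq_bigr => z _; rewrite [in RHS](reindex_inj (addrI (dot y z))) /= mulr_sumr.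
by apply: eq_bigr => s _; rewrite !dotDr !dotZr xw yw mulr0 mulr1 addr0.
Qed.

Lemma sum_sign_eq0 : \sum_(s : F) (-1) ^+ (s == 0) = q - 2%:R :> K.
Proof.
rewrite (bigD1 0) //= eqxx expr1 (eq_bigr (fun=> 1)) => [|s /negbTE-> //].
rewrite sumr_const (cardC1 (0 : F)).
have : (0 < #|F|)%N by apply/card_gt0P; exists 0.
by case: #|F| => // n _; rewrite /= -natr1; ring.
Qed.

Hypotheses (q_neq0 : q != 0) (q_neq1 : q != 1) (qd : q ^+ d = q).

Let sum_proj_pointsE (f : 'rV[F]_d -> K) :
    (forall a x, a != 0 -> f (a *: x) = f x) ->
  (\sum_(x in proj_points) f x) * (q - 1) = \sum_x f x - f 0.
Proof.
move=> /sum_proj_points <-; rewrite -[RHS]mulr_natr; congr (_ * _).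
have : (0 < #|F|)%N by apply/card_gt0P; exists 0.
by case: #|F| => // n _; rewrite -natr1 addrK.
Qed.

Let q1_neq0 : q - 1 != 0. Proof. by rewrite subr_eq0. Qed.

Let dotZ_eq0 x a z : a != 0 -> (dot x (a *: z) == 0) = (dot x z == 0).
Proof. by move=> /negbTE nz_a; rewrite dotZr mulf_eq0 nz_a. Qed.

(** The count (q^d - 1) / (q - 1) is 1 in [K] because q^d = q. *)
Lemma natr_card_proj_points : #|proj_points|%:R = 1 :> K.
Proof.
apply: (mulIf q1_neq0); rewrite -sumr_const sum_proj_pointsE //.
by rewrite sumr_const card_mx mul1n natrX qd mul1r.
Qed.

(** The sum over all vectors is q - 2, and removing the -1 of the zero vector leaves q - 1. *)
Lemma sum_incidence x : x \in proj_points ->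
  \sum_(z in proj_points) (-1) ^+ (dot x z == 0) = 1 :> K.
Proof.
move=> /proj_point_dual[u xu]; apply: (mulIf q1_neq0).
rewrite sum_proj_pointsE => [|a z nz_a]; last by rewrite dotZ_eq0.
rewrite dot0r eqxx expr1; apply: (mulfI q_neq0); rewrite mulrBr.
rewrite (sum_dot (fun s => (-1) ^+ (s == 0)) xu) qd sum_sign_eq0.
by ring.
Qed.

(** The sum over all vectors is (q - 2)^2 / q, and removing the 1 of the zero vector leaves (q - 1)
    (q - 4) / q. *)
Lemma sum_incidence2 x y : x \in proj_points -> y \in proj_points -> x != y ->
  \sum_(z in proj_points) (-1) ^+ ((dot x z == 0) (+) (dot y z == 0))
    = 1 - 4%:R / q :> K.
Proof.
move=> xP yP nxy; have [u [w [xu yu xw yw]]] := proj_points_indep xP yP nxy.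
apply: (mulIf q1_neq0).
rewrite sum_proj_pointsE => [|a z nz_a]; last by rewrite !dotZ_eq0.
rewrite !dot0r !eqxx expr0; under eq_bigr do rewrite signr_addb.
have := sum_dot2 (fun s => (-1) ^+ (s == 0)) (fun s => (-1) ^+ (s == 0)) xu yu xw yw.
rewrite qd sum_sign_eq0; set S := (\sum_z _) => ES.
have {}ES : S = (q - 2%:R) ^+ 2 / q.
  by apply: (mulfI (expf_neq0 2 q_neq0)); rewrite ES; field.
by rewrite ES; field.
Qed.

(** The relation (n + 1) q = 4 turns 1 - 4 / q into 1 - (n + 1), the inner product that inflation
    asks of a block. *)
Lemma has_hadamard_proj n : n.+1%:R * q = 4%:R ->
  has_hadamard K n.+1 -> has_hadamard K (n + #|proj_points|).
Proof.
move=> nq; rewrite -[X in (n + X)%N]card_ord.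
have n4 : n.+1%:R = 4%:R / q by rewrite -nq mulfK.
apply: (@has_hadamard_inflate _ _ _
  (fun a b => dot (enum_val a) (enum_val b) == 0)) => [|a|a b nab].
- by rewrite card_ord natr_card_proj_points.
- rewrite -(big_enum_val (A := mem proj_points)
    (fun z => (-1) ^+ (dot (enum_val a) z == 0))) /=.
  exact/sum_incidence/enum_valP.
- rewrite -(big_enum_val (A := mem proj_points) (fun z =>
    (-1) ^+ ((dot (enum_val a) z == 0) (+) (dot (enum_val b) z == 0)))) /=.
  rewrite n4; apply: sum_incidence2; try exact: enum_valP.
  by apply: contraNneq nab => /enum_val_inj ->.
Qed.

End IncidenceSums.

End ProjectiveGeometry.

(** * Repeated inflation, and the passage to MH(n,p) *)

(** PG(o, r) has G + 1 points, so each inflation adds G. As G = 0 in [K], the relation n r = 4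
    survives and the step can be repeated. *)
Lemma has_hadamard_add (K : fieldType) (r o n k : nat) :
    prime_power r -> (r%:R : K)%R != 0%R -> (r%:R : K)%R != 1%R ->
    (r%:R ^+ o)%R = 1%R :> K -> 0 < n -> (n%:R * r%:R = 4%:R :> K)%R ->
  has_hadamard K n -> has_hadamard K (n + k * (r * \sum_(t < o) r ^ t)).
Proof.
move=> [l [e [l_pr e_gt0 def_r]]] r0 r1 ro n_gt0 nr hn.
have [F _ cardF] := pPrimePowerField l_pr e_gt0.
rewrite -def_r in cardF; set G := r * _.
have r_gt1 : 1 < r by rewrite def_r -(exp1n e) ltn_exp2r ?prime_gt1.
have cardP : #|proj_points F o.+1| = G.+1.
  have := card_proj_points F o.+1; rewrite cardF => E.
  have r1_gt0 : 0 < r.-1 by rewrite -subn1 subn_gt0.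
  apply/eqP; rewrite -(eqn_pmul2r r1_gt0) E predn_exp mulnC eqn_pmul2r //.
  rewrite big_ord_recl expn0 add1n eqSS /G big_distrr /=.
  by apply/eqP; apply: eq_bigr => t _; rewrite expnS.
have rG : (G%:R = 0 :> K)%R.
  apply/eqP; rewrite -(inj_eq (GRing.addrI 1%R)) nat1r -cardP GRing.addr0.
  by rewrite natr_card_proj_points ?cardF // exprS ro mulr1.
elim: k => [|k IHk]; first by rewrite addn0.
have -> : n + k.+1 * G = (n + k * G).-1 + #|proj_points F o.+1|.
  by rewrite cardP; lia.
have nG_gt0 : 0 < n + k * G by rewrite addn_gt0 n_gt0.
apply: has_hadamard_proj; rewrite ?cardF ?(prednK nG_gt0) //.
  by rewrite exprS ro mulr1.
by rewrite natrD natrM rG mulr0 addr0.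
Qed.
Lemma has_hadamard_MH p n : prime p -> has_hadamard 'F_p n -> MH_exists n p.
Proof.
move=> p_pr [h hP]; exists (\matrix_(x, y) (-1) ^+ h x y)%R; split=> x y.
  by rewrite mxE; case: (h x y); [right | left].
apply/eqP; rewrite eqz_mod_dvd (dvdz_pcharf (pchar_Fp p_pr)) rmorphB subr_eq0.
rewrite !mxE rmorph_sum /=; under eq_bigr do
  rewrite !mxE rmorphM !rmorphXn /= rmorphN1 -signr_addb.
have [->|nxy] := eqVneq x y; last by rewrite hP //= mulr0n.
under eq_bigr do rewrite addbb expr0.
by rewrite sumr_const card_ord /= mulr1n mulrz_nat.
Qed.

(** * Geometric sums, powers of 2 and residues modulo p *)

Lemma odd_sumX r u : odd r -> odd (\sum_(t < u) r ^ t) = odd u.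
Proof.
move=> r_odd; elim: u => [|u IHu]; first by rewrite big_ord0.
by rewrite big_ord_recr oddD IHu oddX r_odd orbT addbT.
Qed.

(** Doubling the number m of terms multiplies the sum by 1 + r^m, which is 2 modulo 4, so exactly
    one factor 2 is gained. *)
Lemma sumX_2adic r u e : r = 1 %[mod 4] -> odd u ->
  exists2 g, odd g & \sum_(t < 2 ^ e * u) r ^ t = 2 ^ e * g.
Proof.
move=> r4 u_odd; have r_odd : odd r by lia.
elim: e => [|e [g g_odd IHe]].
  by exists (\sum_(t < u) r ^ t); rewrite ?odd_sumX ?mul1n.
set m := 2 ^ e * u in IHe.
have rm4 : r ^ m = 1 %[mod 4] by rewrite -modnXm r4 modnXm exp1n.
have -> : \sum_(t < 2 ^ e.+1 * u) r ^ t = (1 + r ^ m) * \sum_(t < m) r ^ t.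
  rewrite expnS -mulnA -/m mul2n -addnn big_split_ord mulnDl mul1n big_distrr /=.
  by congr (_ + _); apply: eq_bigr => t _; rewrite expnD.
pose h := (1 + r ^ m) %/ 2.
have def_h : 1 + r ^ m = 2 * h by rewrite /h; lia.
have h_odd : odd h by rewrite /h; lia.
exists (h * g); first by rewrite oddM h_odd.
by rewrite IHe def_h expnS; ring.
Qed.

Lemma pow2_mod_solve k g D : odd g -> exists2 t, t < g & 2 ^ k * t = D %[mod g].
Proof.
move=> g_odd; have g_gt0 := odd_gt0 g_odd.
(* By Euler's theorem [(2 ^ k) ^ (totient g).-1] inverts 2^k modulo g. *)
exists ((2 ^ k) ^ (totient g).-1 * D %% g); first by rewrite ltn_mod.
rewrite modnMmr mulnA -expnS prednK ?totient_gt0 //.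
rewrite -modnMml Euler_exp_totient ?modnMml ?mul1n //.
by rewrite coprimeXl // coprime2n.
Qed.

Lemma repunit_sum q d : 1 < q -> repunit q d = \sum_(t < d) q ^ t.
Proof.
by move=> q_gt1; rewrite /repunit !subn1 predn_exp mulKn // -subn1 subn_gt0.
Qed.

Lemma repunit_mod p q d : 1 < q -> q = 1 %[mod p] -> repunit q d = d %[mod p].
Proof.
move=> q_gt1 q1; rewrite repunit_sum // -modn_summ.
rewrite (eq_bigr (fun=> 1 %% p)) => [|t _]; last by rewrite -modnXm q1 modnXm exp1n.
by rewrite modn_summ sum1_card card_ord.
Qed.

Lemma eq_natr_Fp p m n : prime p -> (m%:R = n%:R :> 'F_p)%R <-> m = n %[mod p].
Proof.
move=> p_pr; split=> [mn | mn].
  by rewrite -!val_Fp_nat // mn.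
by apply: val_inj; rewrite /= !val_Fp_nat.
Qed.

Lemma Fp_expf_pred p (x : 'F_p) : prime p -> x != 0%R -> (x ^+ p.-1 = 1)%R.
Proof.
move=> p_pr x0; apply: (mulfI x0); rewrite mulr1 -exprS prednK ?prime_gt0 //.
by rewrite -{2}(expf_card x) card_Fp.
Qed.

Lemma pow2_Fp p (x : 'F_p) e : prime p -> two_primitive_root p -> x != 0%R ->
  exists2 s, e <= s & (x = 2%:R ^+ s)%R.
Proof.
move=> p_pr p_root2 x0.
have p1_gt0 : 0 < p.-1 by rewrite -subn1 subn_gt0 prime_gt1.
have [s ->] := prim_rootP p_root2 (Fp_expf_pred p_pr x0).
(* Adding multiples of p - 1 enlarges the exponent without changing the power. *)
exists (s + p.-1 * e); first by rewrite (leq_trans _ (leq_addl _ _)) // leq_pmull.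
by rewrite exprD exprM (prim_expr_order p_root2) expr1n mulr1.
Qed.

(** * Covering all large admissible orders *)

(** Here x stands for 4 / n; the bound may depend on x, as there are finitely many residues. *)
Lemma has_hadamard_large p i j (x : 'F_p) :
    prime p -> two_primitive_root p -> 1 <= i ->
    p = 2 ^ i + 1 %[mod 2 ^ i.+1] -> repunit_condition p -> j <= i ->
    (exists a : 'F_p, x = a ^+ (2 ^ j))%R ->
  exists N, forall n, N <= n -> (n%:R * x = 4%:R)%R -> 2 ^ (i - j) %| n ->
    has_hadamard 'F_p n.
Proof.
move=> p_pr p_root2 i_ge1 p_mod p_cond j_le_i [a def_x].
have [->|x1] := eqVneq x 1%R.
  by exists 0 => n _; rewrite mulr1 => n4 _; apply: has_hadamard_eq4.
pose e := i - j; have p_gt1 := prime_gt1 p_pr.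
have [u u_odd def_p] : exists2 u, odd u & p.-1 = 2 ^ i * u.
  exists (2 * (p %/ 2 ^ i.+1) + 1); first by rewrite oddD oddM.
  have := divn_eq p (2 ^ i.+1); rewrite p_mod modn_small; last first.
    by rewrite expnS mul2n -addnn ltn_add2l -{1}(expn0 2) ltn_exp2l.
  by rewrite addnA addn1 => {1}->; rewrite /= expnS; ring.
have p_odd : odd p.
  have := congr1 odd def_p; rewrite oddM oddX /= orbF; lia.
have p4 : (4%:R : 'F_p)%R != 0%R.
  rewrite -(dvdn_pcharf (pchar_Fp p_pr)) (Euclid_dvdX 2 2 p_pr) dvdn_prime2 //.
  by rewrite andbT; apply: contraTneq p_odd => ->.
have [x0|x0] := eqVneq x 0%R.
  by exists 0 => n _; rewrite x0 mulr0 => /esym/eqP; rewrite (negbTE p4).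
have a0 : a != 0%R by apply: contraNneq x0 => a0; rewrite def_x a0 expr0n expn_eq0.
(* This choice gives x^o = a^(2^j o) = a^(p - 1) = 1. *)
pose o := 2 ^ e * u.
have xo : (x ^+ o = 1)%R.
  by rewrite def_x -exprM /o mulnA -expnD subnKC // -def_p Fp_expf_pred.
have [r [r_pp rx r4]] : exists r, [/\ prime_power r, (r%:R = x)%R & r = 1 %[mod 4]].
  have lt_x : val x < p by rewrite -[leqRHS](Fp_cast p_pr) ltn_ord.
  (* The repunit is d modulo p because q = 1 modulo p, so taking x itself as delta yields r = x. *)
  have [|q [d [[q_odd q_pp q1] [d_gt0 dx r_pp r4]]]] := p_cond (val x).
    by rewrite lt_x andbT lt0n.
  exists (repunit q d); split=> //.
  have q_gt1 : 1 < q.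
    by case: q_pp => l [f [l_pr f_gt0 ->]]; rewrite -(exp1n f) ltn_exp2r ?prime_gt1.
  rewrite -[RHS]natr_Zp; apply/eq_natr_Fp => //.
  by rewrite repunit_mod.
have [g g_odd def_g] := sumX_2adic e r4 u_odd.
pose G := r * \sum_(t < o) r ^ t.
have def_G : G = 2 ^ e * (r * g) by rewrite /G def_g mulnCA.
have rg_odd : odd (r * g) by rewrite oddM g_odd andbT; lia.
(* Having s >= e makes 2^e divide every starting order. *)
have [s e_le_s def_s] := pow2_Fp e p_pr p_root2 (invr_neq0 x0).
(* The t chosen below is less than r g <= G, so this bounds the starting order. *)
exists (2 ^ s * (4 + p * G)) => n n_ge nx e_n.
have s4_le : 2 ^ s * 4 <= n by rewrite (leq_trans _ n_ge) // leq_mul2l leq_addr orbT.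
have : p * 2 ^ e %| n - 2 ^ s * 4.
  rewrite Gauss_dvd ?coprimeXr // ?coprimen2 //; apply/andP; split; last first.
    by rewrite dvdn_sub // dvdn_mulr // dvdn_exp2l.
  rewrite -eqn_mod_dvd //; apply/eqP/eq_natr_Fp => //.
  by rewrite natrM natrX -def_s -nx mulrCA mulVf // mulr1.
case/dvdnP=> D def_D.
(* As n - 4 * 2^s = 2^e p D and G = 2^e r g, solving 2^(s - e) t = D modulo r g makes n0 = n modulo
   G. *)
have [t t_lt tD] := pow2_mod_solve (s - e) D rg_odd.
pose n0 := 2 ^ s * (4 + p * t).
have n0_le : n0 <= n.
  rewrite (leq_trans _ n_ge) // leq_mul2l leq_add2l leq_mul2l def_G.
  by rewrite (leq_trans (ltnW t_lt)) ?orbT // leq_pmull // expn_gt0.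
have : G %| n - n0.
  rewrite -eqn_mod_dvd // -(subnKC s4_le) def_D /n0 mulnDr eqn_modDl.
  have -> : 2 ^ s * (p * t) = 2 ^ e * (p * (2 ^ (s - e) * t)).
    by rewrite -{1}(subnKC e_le_s) expnD; ring.
  have -> : D * (p * 2 ^ e) = 2 ^ e * (p * D) by ring.
  by rewrite def_G -!muln_modr -(modnMmr _ (_ * t)) tD modnMmr.
case/dvdnP=> k def_k; rewrite -(subnKC n0_le) def_k.
have n0x : (n0%:R * x = 4%:R)%R.
  rewrite natrM natrX -def_s natrD natrM pchar_Fp_0 // mul0r addr0.
  by rewrite mulrAC mulVf ?mul1r.
apply: has_hadamard_add => //; rewrite ?rx //.
  by rewrite muln_gt0 expn_gt0.
apply/has_hadamard_pow2/has_hadamard_eq4.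
by rewrite natrD natrM pchar_Fp_0 // mul0r addr0.
Qed.

Theorem theorem5p6 (p i j : nat)
  (p_prime : prime p)
  (p_root2 : two_primitive_root p)
  (i_ge1 : 1 <= i)
  (p_mod : p = 2 ^ i + 1 %[mod 2 ^ i.+1])
  (p_cond : repunit_condition p)
  (j_le_i : j <= i) :
  exists E : seq nat, forall n : nat, 0 < n -> n \notin E ->
    (n%:R : 'F_p)%R \is a GRing.unit ->
    (exists a : int, (4%:R / n%:R = a%:~R ^+ (2 ^ j) :> 'F_p)%R) ->
    n = 0 %[mod 2 ^ (i - j)] ->
    MH_exists n p.
Proof.
have /fin_all_exists[N NP] : forall a : 'F_p, exists N, forall n, N <= n ->
    (n%:R * a ^+ (2 ^ j) = 4%:R)%R -> 2 ^ (i - j) %| n -> has_hadamard 'F_p n.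
  by move=> a; apply: (has_hadamard_large (i := i) (j := j)) => //; exists a.
(* The exceptions are the integers below the largest of the bounds, one per residue a. *)
exists (iota 0 (\max_a N a)) => n _ n_large n_unit [a def_a] n_mod.
rewrite mem_iota /= add0n -leqNgt in n_large.
apply: has_hadamard_MH => //; apply: (NP (a%:~R)%R).
- exact: leq_trans (leq_bigmax _) n_large.
- by rewrite -def_a mulrC divrK.
- by apply/eqP; rewrite n_mod mod0n.
Qed.
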